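(* For every positive integer $n$ with prime factorization $n = p_1^{\alpha_1} p_2^{\alpha_2} \cdots p_m^{\alpha_m}$, $$rb(\mathbb{Z}_n,1) = 2+\sum_{i=1}^{m} \alpha_i\big(rb(\mathbb{Z}_{p_i},1)-2\big).$$
   Context: $\mathbb{Z}_n$ denotes the cyclic group of order $n$. An $r$-coloring of $\mathbb{Z}_n$ is a surjective map $c:\mathbb{Z}_n\to\{1,\dots,r\}$. For a fixed integer $k$, a triple is any $(x_1,x_2,x_3)\in\mathbb{Z}_n^3$ with $x_1+x_2\equiv kx_3 \pmod n$. A triple is rainbow under $c$ if $c(x_1),c(x_2),c(x_3)$ are pairwise distinct; $c$ is rainbow-free if no triple is rainbow. The rainbow number $rb(\mathbb{Z}_n,k)$ is the smallest positive integer $r$ such that every $r$-coloring of $\mathbb{Z}_n$ admits a rainbow triple (by convention $rb(\mathbb{Z}_n,k)=n+1$ if no such $r$ exists). *)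

(* Defs.v *)
From mathcomp Require Import all_boot all_order all_algebra.

Set Implicit Arguments.
Unset Strict Implicit.
Unset Printing Implicit Defensive.

(* Z_n is carried by 'I_n with congruences mod n rather than by 'Z_n, because
   'Z_1 has two elements. *)

Definition triple (n : nat) (k : int) (x1 x2 x3 : 'I_n) : bool :=
  (x1%:Z + x2%:Z == k * x3%:Z %[mod n%:Z])%Z.

Definition surjective_col (n r : nat) (c : {ffun 'I_n -> 'I_r}) : bool :=
  [forall j, exists x, c x == j].

Definition rainbow (n r : nat) (c : {ffun 'I_n -> 'I_r}) (x1 x2 x3 : 'I_n) :
    bool :=
  uniq [:: c x1; c x2; c x3].

Definition rainbow_free (n r : nat) (k : int) (c : {ffun 'I_n -> 'I_r}) : bool :=
  [forall x1, forall x2, forall x3,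
     triple k x1 x2 x3 ==> ~~ rainbow c x1 x2 x3].

Definition forces_rainbow (n : nat) (k : int) (r : nat) : bool :=
  [forall c : {ffun 'I_n -> 'I_r}, surjective_col c ==> ~~ rainbow_free k c].

Lemma forces_rainbow_succ (n : nat) (k : int) : forces_rainbow n k n.+1.
Proof.
apply/forallP=> c; apply/implyP=> /forallP csurj.
have : #|'I_n.+1| <= #|[seq c x | x : 'I_n]|.
  apply/subset_leq_card/subsetP=> j _.
  by have /existsP[x /eqP <-] := csurj j; apply: image_f.
by move=> /leq_trans/(_ (leq_image_card _ _)); rewrite !card_ord ltnn.
Qed.

Lemma rb_exists (n : nat) (k : int) :
  exists r, (0 < r) && forces_rainbow n k r.
Proof. by exists n.+1; rewrite forces_rainbow_succ. Qed.

(* There is no (n+1)-coloring of Z_n, so r = n+1 always qualifies vacuously and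
   the minimum is n+1 exactly when no r <= n qualifies: the convention
   rb(Z_n, k) = n+1 needs no separate clause. *)
Definition rb (n : nat) (k : int) : nat := ex_minn (rb_exists n k).

(* Main.v *)
(** Let m(n) = rb(n, 1) - 1 be the largest number of colors of a rainbow-free
    coloring of Z_n; the claim is that m - 1 is completely additive. Given a
    rainbow-free coloring of Z_(pt), let P0 be the set of colors on the subgroup
    pZ, a copy of Z_t. Each coset of pZ carries at most one color outside P0, and
    coloring the coset by that color, or by a blank when there is none, is
    rainbow-free on Z_p: hence m(pt) <= m(t) + m(p) - 1. Conversely, color pZ by
    a coloring of Z_t and the remaining residues by the nonzero classes of a
    coloring of Z_p; this is rainbow-free as soon as the latter is even, and for
    p prime every rainbow-free coloring with three colors or more is even. *)

Require Import Defs.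
From mathcomp Require Import all_boot all_order all_algebra.
From mathcomp Require Import zify ring.

Set Implicit Arguments.
Unset Strict Implicit.
Unset Printing Implicit Defensive.
Import GRing.Theory.
Local Open Scope ring_scope.

(** * Colorings of [Z_n] as periodic functions on the integers *)

Definition periodic (n : nat) (T : eqType) (f : int -> T) :=
  forall x y : int, (n%:Z %| x - y)%Z -> f x = f y.

(** For [k = 1] the first two entries of a triple determine the third modulo [n], so two variables
    express rainbow-freeness. *)
Definition schur_free (T : eqType) (f : int -> T) :=
  forall x y : int, ~~ uniq [:: f x; f y; f (x + y)].

(* Colorings of [Z_n] with at least [r] colors, pulled back to [int]. *)
Definition colorable (n r : nat) :=
  exists (T : eqType) (f : int -> T) (s : seq int),
    [/\ periodic n f, schur_free f, uniq (map f s) & (r <= size s)%N].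

Lemma dvdz_modz_sub (n x : int) : (n %| x - (x %% n)%Z)%Z.
Proof. by rewrite -eqz_mod_dvd modz_mod. Qed.

Lemma dvdz_sub_sym (d x y : int) : (d %| x - y)%Z -> (d %| y - x)%Z.
Proof. by rewrite -!eqz_mod_dvd eq_sym. Qed.

Lemma dvdz_sub_trans (d x y z : int) :
  (d %| x - y)%Z -> (d %| y - z)%Z -> (d %| x - z)%Z.
Proof. by rewrite -!eqz_mod_dvd => /eqP->. Qed.

Lemma schur_freeP (T : eqType) (f : int -> T) (x y : int) : schur_free f ->
  [\/ f x = f y, f (x + y) = f x | f (x + y) = f y].
Proof.
move=> /(_ x y); rewrite /= !inE andbT negb_and !negbK.
case/orP=> [/orP[]|] /eqP ->; by [constructor 1|constructor 2|constructor 3].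
Qed.

Lemma schur_free_intro (T : eqType) (f : int -> T) :
  (forall x y, [\/ f x = f y, f (x + y) = f x | f (x + y) = f y]) ->
  schur_free f.
Proof.
by move=> h x y; case: (h x y) => /= ->; rewrite !inE eqxx ?orbT ?andbF.
Qed.

Lemma colorable0 (n : nat) : colorable n 0.
Proof. by exists unit, (fun=> tt), [::]; split. Qed.

(** Below [rb], minimality supplies a rainbow-free coloring. Conversely, a rainbow-free coloring
    with at least [rb] colors could be merged into one with exactly [rb] colors, since merging
    colors creates no rainbow triple. *)
Lemma lt_rb_colorable (n r : nat) : (0 < n)%N ->
  (r < rb n 1)%N <-> colorable n r.
Proof.
case: n => // n _; have nz : (n.+1)%:Z != 0 by [].
pose red (x : int) : 'I_n.+1 := inord `|(x %% n.+1%:Z)%Z|%N.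
have redE x : (red x)%:Z = (x %% n.+1%:Z)%Z.
  have ge0 := modz_ge0 x nz; have lt := ltz_mod x nz.
  by rewrite /red inordK ?gez0_abs //; lia.
rewrite /rb; case: ex_minnP => m /andP[m_gt0 m_forces] m_min; split.
  case: r => [|r] ltrm; first exact: colorable0.
  have : ~~ forces_rainbow n.+1 1 r.+1.
    by apply/negP => fr; have := m_min r.+1 fr; rewrite leqNgt ltrm.
  case/forallPn => c; rewrite negb_imply negbK => /andP[/forallP surj free].
  have pre j : exists x, c x == j by apply/existsP.
  exists 'I_r.+1, (c \o red),
    [seq (nat_of_ord (xchoose (pre j)))%:Z | j <- enum 'I_r.+1].
  have redK (i : 'I_n.+1) : red i%:Z = i.
    apply: val_inj; apply/eqP; rewrite -eqz_nat redE modz_small //.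
    by rewrite lez_nat ltz_nat ltn_ord.
  split.
  - move=> x y; rewrite -eqz_mod_dvd => /eqP exy /=.
    by rewrite /red exy.
  - move=> x y /=.
    have /forallP/(_ (red x))/forallP/(_ (red y))/forallP/(_ (red (x + y))) := free.
    move=> /implyP; apply.
    by rewrite /triple !redE mul1r modzDm modz_mod.
  - rewrite -map_comp (eq_map (g := id)) ?map_id ?enum_uniq // => j /=.
    by rewrite redK; apply/eqP; exact: (xchooseP (pre j)).
  - by rewrite size_map size_enum_ord.
case=> T [f [s [fper ffree funiq les]]]; rewrite ltnNge; apply/negP => lemr.
case: m m_gt0 m_forces {m_min} lemr => // m _ /forallP m_forces ltmr.
(* All colors of index at least [m], including those absent from [map f s], are merged into the last
   color. *)
pose c := [ffun i : 'I_n.+1 => inord (minn (index (f i%:Z) (map f s)) m) : 'I_m.+1].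
have /implyP := m_forces c; have -> : surjective_col c.
  apply/forallP => j; apply/existsP; exists (red (nth 0 s j)); rewrite ffunE.
  have ltj : (j < size s)%N by have := ltn_ord j; lia.
  rewrite redE -(fper _ _ (dvdz_modz_sub _ _)).
  rewrite -(nth_map 0 (f 0)) // index_uniq ?size_map //.
  by apply/eqP/val_inj; rewrite /= inordK; have := ltn_ord j; lia.
move=> /(_ isT)/negP; apply.
apply/forallP=> x1; apply/forallP=> x2; apply/forallP=> x3; apply/implyP.
rewrite /triple mul1r eqz_mod_dvd => /fper e3.
rewrite /rainbow; apply/negP => rb3; have := ffree x1%:Z x2%:Z.
rewrite e3 -[uniq _]/(uniq (map f [:: x1%:Z; x2%:Z; x3%:Z])).
move/negP; apply.
apply: (@map_uniq _ _ (fun v => inord (minn (index v (map f s)) m) : 'I_m.+1)).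
by move: rb3; rewrite !ffunE.
Qed.

(** * Upper bound: splitting a coloring of [Z_(pt)] *)

(* A coset of [pZ] contains at most one color that does not occur on [pZ]: two
   elements of the coset with distinct such colors, together with their
   difference, would form a rainbow triple. *)
Lemma colorable_mul_upper (p t r : nat) : (0 < p)%N -> (0 < t)%N ->
  colorable (p * t) r ->
  exists a b, [/\ colorable t a, colorable p b & (r < a + b)%N].
Proof.
move=> p_gt0 t_gt0 [T [f [s [fper ffree funiq les]]]].
have tz : t%:Z != 0 by lia.
pose P0 v := [exists i : 'I_t, f (p%:Z * i%:Z) == v].
(* By periodicity modulo [p * t], indices below [t] exhaust the colors of a coset of [pZ]; hence
   [P0] and the [pick] in [h] can range over ['I_t]. *)
have toI (x k : int) : exists i : 'I_t, f (x + p%:Z * k) = f (x + p%:Z * i%:Z).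
  have ge0 := modz_ge0 k tz; have lt := ltz_mod k tz.
  have lti : (`|(k %% t%:Z)%Z|%N < t)%N by lia.
  exists (Ordinal lti); apply: fper; rewrite /= gez0_abs //.
  have -> : x + p%:Z * k - (x + p%:Z * (k %% t%:Z)%Z) =
            p%:Z * (k - (k %% t%:Z)%Z) by ring.
  by rewrite PoszM dvdz_mul // dvdz_modz_sub.
have P0mul k : P0 (f (p%:Z * k)).
  have [i] := toI 0 k; rewrite !add0r => e.
  by apply/existsP; exists i; rewrite e.
have P0dvd x : (p%:Z %| x)%Z -> P0 (f x) by move=> /dvdzP[k ->]; rewrite mulrC.
have unique x y : (p%:Z %| x - y)%Z -> ~~ P0 (f x) -> ~~ P0 (f y) -> f x = f y.
  move=> /P0dvd dxy; case: (schur_freeP y (x - y) ffree) => [->||].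
  - by rewrite dxy.
  - by rewrite addrC subrK => ->.
  - by rewrite addrC subrK => ->; rewrite dxy.
pose h (x : int) : option T :=
  omap (fun i : 'I_t => f (x + p%:Z * i%:Z))
       [pick i : 'I_t | ~~ P0 (f (x + p%:Z * i%:Z))].
have hSome x y : (p%:Z %| y - x)%Z -> ~~ P0 (f y) -> h x = Some (f y).
  move=> /dvdzP[k ek] yP; have [i ei] := toI x k.
  have ey : f y = f (x + p%:Z * i%:Z) by rewrite -ei mulrC -ek addrC subrK.
  rewrite /h; case: pickP => [j jP|/(_ i)] /=; last by rewrite -ey yP.
  rewrite ey; congr Some; apply: unique; rewrite // -?ey //.
  have -> : x + p%:Z * j%:Z - (x + p%:Z * i%:Z) = p%:Z * (j%:Z - i%:Z) by ring.
  exact: dvdz_mulr.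
have hP x : (exists y, [/\ (p%:Z %| y - x)%Z, ~~ P0 (f y) & h x = Some (f y)])
            \/ h x = None.
  rewrite /h; case: pickP => [j jP|_] /=; [left|by right].
  by exists (x + p%:Z * j%:Z); rewrite addrC addKr dvdz_mulr.
have hNone x : h x = None -> forall y, (p%:Z %| y - x)%Z -> P0 (f y).
  by move=> hx y dy; case: (boolP (P0 (f y))) => // /(hSome _ _ dy); rewrite hx.
have hper : periodic p h.
  move=> x y dxy; case: (hP x) => [[z [dz zP ->]]|hx].
    by apply/esym/hSome => //; apply: dvdz_sub_trans dxy.
  case: (hP y) => [[z [dz zP hy]]|->] //.
  by move: zP; rewrite (hNone _ hx) //; apply/(dvdz_sub_trans dz)/dvdz_sub_sym.
have hfree : schur_free h.
  apply: schur_free_intro => x y.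
  case: (hP x) => [[x' [dx xP hx]]|hx]; case: (hP y) => [[y' [dy yP hy]]|hy].
  - have dz : (p%:Z %| (x' + y') - (x + y))%Z.
      by rewrite opprD addrACA rpredD.
    rewrite hx hy; case: (schur_freeP x' y' ffree) => [->|e|e].
    + by constructor 1.
    + by constructor 2; rewrite -e; apply: hSome; rewrite // e.
    + by constructor 3; rewrite -e; apply: hSome; rewrite // e.
  - case: (hP (x + y)) => [[z [dz zP hz]]|->]; last by constructor 3.
    (* The coset of [y] is blank, so the color of [z - x'] occurs on [pZ]; the triple [z - x'],
       [x'], [z] then forces [f z = f x']. *)
    have yP : P0 (f (z - x')).
      apply: (hNone _ hy).
      have -> : z - x' - y = z - (x + y) - (x' - x) by ring.
      exact: rpredB.
    rewrite hx hz; case: (schur_freeP (z - x') x' ffree); rewrite ?subrK => e.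
    + by move: xP; rewrite -e yP.
    + by move: zP; rewrite e yP.
    + by constructor 2; rewrite e.
  - case: (hP (x + y)) => [[z [dz zP hz]]|->]; last by constructor 2.
    have xP : P0 (f (z - y')).
      apply: (hNone _ hx).
      have -> : z - y' - x = z - (x + y) - (y' - y) by ring.
      exact: rpredB.
    rewrite hy hz; case: (schur_freeP (z - y') y' ffree); rewrite ?subrK => e.
    + by move: yP; rewrite -e xP.
    + by move: zP; rewrite e xP.
    + by constructor 3; rewrite e.
  - by constructor 1; rewrite hx hy.
(* The samples in [s] are split by whether their color occurs on [pZ]; the extra [.+1] counts the
   blank, which is the value of [h] at [0]. *)
exists (count (P0 \o f) s), (count (predC (P0 \o f)) s).+1; split.
- pose pre v : int := if [pick i : 'I_t | f (p%:Z * i%:Z) == v] is Some i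
                      then i%:Z else 0.
  have preK v : P0 v -> f (p%:Z * pre v) = v.
    move=> /existsP[i iP]; rewrite /pre; case: pickP => [j /eqP //|/(_ i)].
    by rewrite iP.
  exists T, (fun x => f (p%:Z * x)), [seq pre (f x) | x <- s & P0 (f x)].
  split.
  + by move=> x y d; apply: fper; rewrite -mulrBr PoszM dvdz_mul.
  + by move=> x y; rewrite mulrDr; apply: ffree.
  + rewrite -map_comp (eq_in_map _ f _).1; last first.
      by move=> x; rewrite mem_filter => /andP[xP _]; apply: preK.
    by apply: subseq_uniq funiq; apply/map_subseq/filter_subseq.
  + by rewrite size_map size_filter.
- exists (option T), h, (0 :: filter (predC (P0 \o f)) s); split => //=.
  + have -> : h 0 = None.
      case: (hP 0) => [[y [dy yP _]]|//].
      by move: yP; rewrite P0dvd //; rewrite subr0 in dy.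
    have -> : map h (filter (predC (P0 \o f)) s) =
              map Some (map f (filter (predC (P0 \o f)) s)).
      rewrite -map_comp; apply/eq_in_map => x; rewrite mem_filter => /andP[xP _].
      by apply: hSome => //; rewrite subrr dvdz0.
    rewrite map_inj_uniq; last by move=> ? ? [].
    apply/andP; split; first by apply/mapP => -[].
    by apply: subseq_uniq funiq; apply/map_subseq/filter_subseq.
  + by rewrite size_filter.
- by rewrite addnS ltnS count_predC.
Qed.

(** * Lower bound: evenness modulo a prime and gluing *)

(* If [f (- x) = f 0 <> f x] and [f y] is a third color, then the two ways of
   writing [y] and [y - x] as sums force [f (y - x) = f y]; iterating, [f] would
   be constant because [x] generates [Z_p]. *)
Lemma schur_free_prime_even (p : nat) (T : eqType) (f : int -> T) (s : seq int) :
  prime p -> periodic p f -> schur_free f -> uniq (map f s) ->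
  (2 < size s)%N -> forall x, f (- x) = f x.
Proof.
move=> p_pr fper ffree funiq les.
(* The triple [x], [- x], [0] makes [f x] and [f (- x)] equal unless one of them is [f 0]; [key]
   then makes the other one [f 0] too. *)
suff key x : f (- x) = f 0 -> f x = f 0.
  move=> x; case: (schur_freeP x (- x) ffree) => [->//||]; rewrite subrr => e.
  - by rewrite -e; apply: key; rewrite opprK -e.
  - by rewrite -e (key x).
move=> efN; apply/eqP/negPn/negP => nefx.
have [y efy] : exists y, f y \notin [:: f x; f 0].
  case: (boolP (all (mem [:: f x; f 0]) (map f s))) => [/allP sub|].
    by have := uniq_leq_size funiq sub; rewrite size_map leqNgt les.
  by case/allPn => _ /mapP[y _ ->]; exists y.
move: efy; rewrite !inE negb_or => /andP[nyx ny0].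
have step z : f z = f y -> f (z - x) = f y.
  move=> ez; case: (schur_freeP z (- x) ffree).
  - by rewrite ez efN => e; rewrite e eqxx in ny0.
  - by rewrite ez.
  - rewrite efN => e1; case: (schur_freeP (z - x) x ffree); rewrite ?subrK ?ez.
    + by rewrite e1 => e; rewrite e eqxx in nefx.
    + by move=> <-.
    + by move=> e; rewrite e eqxx in nyx.
have steps (k : nat) : f (y - x * k%:Z) = f y.
  elim: k => [|k IH]; first by rewrite mulr0 subr0.
  by rewrite intS mulrDr mulr1 opprD [X in y + X]addrC addrA step.
have cop : coprimez x p%:Z.
  rewrite coprimezE absz_nat coprime_sym prime_coprime //; apply/negP => dx.
  by move: nefx; rewrite (fper x 0) ?eqxx // subr0 dvdzE.
have [[u v] /= uv] := coprimezP _ _ cop.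
have pz : p%:Z != 0 by have := prime_gt0 p_pr; lia.
(* By Bezout this number of steps, times [x], is congruent to [y] modulo [p], so the walk from [y]
   ends at [0]. *)
have := steps `|((y * u) %% p%:Z)%Z|%N.
rewrite gez0_abs ?modz_ge0 // (fper _ 0) => [e|]; first by rewrite e eqxx in ny0.
rewrite subr0 -[X in (X - _)]mulr1 -uv.
have -> : y * (u * x + v * p%:Z) - x * ((y * u) %% p%:Z)%Z =
  (y * v) * p%:Z + x * (y * u - ((y * u) %% p%:Z)%Z) by ring.
by rewrite rpredD // ?dvdz_mull // dvdz_modz_sub.
Qed.

(** One color is lost because the samples for [Z_p] that are multiples of [p] must be dropped, and
    by periodicity there is at most one. *)
Lemma colorable_mul_lower (p t a b : nat) : prime p -> (0 < b)%N ->
  colorable t a -> colorable p b -> colorable (p * t) (a + b).-1.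
Proof.
move=> p_pr b_gt0 [T1 [f1 [s1 [per1 free1 uniq1 le1]]]] colb.
have [T2 [f2 [s2 [per2 free2 even2 [uniq2 le2 nz2]]]]] :
  exists (T : eqType) (f : int -> T) (s : seq int),
    [/\ periodic p f, schur_free f, forall x, f (- x) = f x &
     [/\ uniq (map f s), (b <= (size s).+1)%N &
         all (fun x => ~~ (p%:Z %| x)%Z) s]].
  case: (leqP b 2) => [b_le2|b_gt2].
    (* For [b <= 2] one color off [pZ] is enough, and a constant coloring is even. *)
    exists unit, (fun=> tt), [:: 1]; split=> //.
    split=> //=; rewrite andbT dvdzE /= dvdn1.
    by case: (p) p_pr => [|[|]].
  have [T [f [s [fper ffree funiq les]]]] := colb.
  have feven := schur_free_prime_even p_pr fper ffree funiq (leq_trans b_gt2 les).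
  exists T, f, [seq x <- s | ~~ (p%:Z %| x)%Z]; split => //; split.
  - by apply: subseq_uniq funiq; apply/map_subseq/filter_subseq.
  - rewrite size_filter (leq_trans les) //.
    rewrite -(count_predC (fun x => (p%:Z %| x)%Z)) -add1n leq_add2r -size_filter.
    rewrite -(size_map f) -[1%N]/(size [:: f 0]); apply: uniq_leq_size.
      by apply: subseq_uniq funiq; apply/map_subseq/filter_subseq.
    move=> _ /mapP[x + ->]; rewrite mem_filter => /andP[dx _].
    by rewrite inE (fper x 0) // subr0.
  - exact: filter_all.
have pz : p%:Z != 0 by have := prime_gt0 p_pr; lia.
pose f (x : int) : T1 + T2 :=
  if (p%:Z %| x)%Z then inl (f1 (x %/ p%:Z)%Z) else inr (f2 x).
exists (T1 + T2)%type, f, ([seq p%:Z * x | x <- s1] ++ s2); split.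
- move=> x y; rewrite PoszM => dxy.
  have dp : (p%:Z %| x - y)%Z by apply: dvdz_trans dxy; apply: dvdz_mulr.
  have dE : (p%:Z %| x)%Z = (p%:Z %| y)%Z.
    by rewrite -[x in LHS](subrK y) rpredDl.
  rewrite /f dE; case: ifP => [dy|_]; last by rewrite (per2 _ _ dp).
  congr inl; apply: per1; move: dxy; rewrite -dE in dy.
  case/dvdzP: (dy) => x' ->; rewrite dE in dy; case/dvdzP: dy => y' ->.
  by rewrite !mulzK // -mulrBl mulrC dvdz_mul2l.
- apply: schur_free_intro => x y; rewrite /f.
  case: (boolP (p%:Z %| x)%Z) => dx; case: (boolP (p%:Z %| y)%Z) => dy.
  + rewrite rpredD //; case/dvdzP: dx => x' ->; case/dvdzP: dy => y' ->.
    rewrite -mulrDl !mulzK //.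
    by case: (schur_freeP x' y' free1) => ->;
      [constructor 1|constructor 2|constructor 3].
  + rewrite rpredDl // (negbTE dy); constructor 3; congr inr; apply: per2.
    by rewrite addrK.
  + rewrite rpredDr // (negbTE dx); constructor 2; congr inr; apply: per2.
    by rewrite addrAC subrr add0r.
  (* When the sum falls in [pZ], [x] is congruent to [- y] modulo [p], and evenness gives [x] and
     [y] the same color. *)
  + case: ifP => [dz|_].
      constructor 1; rewrite -(even2 y); congr inr; apply: per2.
      by rewrite opprK.
    by case: (schur_freeP x y free2) => ->;
      [constructor 1|constructor 2|constructor 3].
- have -> : map f ([seq p%:Z * x | x <- s1] ++ s2) =
            map inl (map f1 s1) ++ map inr (map f2 s2).
    rewrite map_cat -!map_comp; congr cat; first apply: eq_map => x /=.
      by rewrite /f dvdz_mulr // mulKz.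
    by apply/eq_in_map => x /(allP nz2) /negbTE dx; rewrite /f dx.
  rewrite cat_uniq (map_inj_uniq (@inl_inj _ _)) (map_inj_uniq (@inr_inj _ _)).
  rewrite uniq1 uniq2 andbT.
  by apply/hasPn => _ /mapP[? _ ->]; apply/mapP => -[].
- by rewrite size_cat size_map -subn1 leq_subLR add1n -addnS leq_add.
Qed.

(** * Additivity and induction over the factorization *)

Lemma rb_gt1 (n : nat) : (0 < n)%N -> (1 < rb n 1)%N.
Proof.
by move=> n_gt0; apply/lt_rb_colorable => //; exists unit, (fun=> tt), [:: 0].
Qed.

(** The two bounds, applied to the largest color numbers [rb - 1], meet; the [+ 2] avoids truncated
    subtraction. *)
Lemma rb_mul_prime (p t : nat) : prime p -> (0 < t)%N ->
  (rb (p * t) 1 + 2 = rb p 1 + rb t 1)%N.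
Proof.
move=> p_pr t_gt0; have p_gt0 := prime_gt0 p_pr.
have pt_gt0 : (0 < p * t)%N by rewrite muln_gt0 p_gt0.
have := rb_gt1 p_gt0; have := rb_gt1 t_gt0; have := rb_gt1 pt_gt0.
move=> gt1 gt2 gt3.
have ltpred m : (1 < m)%N -> (m.-1 < m)%N by lia.
have [a [b [cola colb ltab]]] := colorable_mul_upper p_gt0 t_gt0
  ((lt_rb_colorable _ pt_gt0).1 (ltpred _ gt1)).
move/(lt_rb_colorable _ t_gt0) : cola; move/(lt_rb_colorable _ p_gt0) : colb.
have b_gt0 : (0 < (rb p 1).-1)%N by lia.
have := colorable_mul_lower p_pr b_gt0
  ((lt_rb_colorable _ t_gt0).1 (ltpred _ gt2))
  ((lt_rb_colorable _ p_gt0).1 (ltpred _ gt3)).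
move/(lt_rb_colorable _ pt_gt0); lia.
Qed.

(** Base case giving the constant 2 of the formula: [Z_1] has no 2-coloring, so [r = 2] qualifies
    vacuously. *)
Lemma rb1 : rb 1 1 = 2%N.
Proof.
apply/eqP; rewrite eqn_leq rb_gt1 // andbT /rb.
by case: ex_minnP => m _; apply; rewrite forces_rainbow_succ.
Qed.

Theorem theorem2 (n : nat) (hn : (0 < n)%N) :
  ((rb n 1)%:Z =
     2 + \sum_(p <- primes n) (logn p n)%:Z * ((rb p 1)%:Z - 2))%R.
Proof.
rewrite [in LHS](prod_prime_decomp hn) prime_decompE big_map /=.
have : all prime (primes n) by apply/allP => p; rewrite mem_primes => /andP[].
(* The induction runs over an arbitrary list of primes, while the exponents remain those of the
   original [n]. *)
elim: (primes n) => [_|p s IH /= /andP[p_pr s_pr]].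
  by rewrite !big_nil rb1.
rewrite !big_cons addrCA -{}IH //.
have : (0 < \prod_(j <- s) j ^ logn j n)%N.
  by rewrite big_seq prodn_cond_gt0.
move: (\prod_(j <- s) _)%N => t t_gt0.
(* Each unit of the exponent splits off one factor [p] and contributes [rb p 1 - 2]. *)
elim: (logn p n) => [|k IHk]; first by rewrite mul1n mul0r add0r.
have := @rb_mul_prime p (p ^ k * t) p_pr; rewrite mulnA -expnS.
rewrite muln_gt0 expn_gt0 prime_gt0 // t_gt0 => /(_ isT).
rewrite (intS k) mulrDl mul1r; lia.
Qed.
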